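(* Let $H$ be an $n$-vertex simple graph with minimum degree at least $h$. There exists a collection $\mathcal F=\{K_1,\dots,K_t\}$ of vertex-disjoint induced subgraphs of $H$ (called expanding cores), where $t=O((n\log n)/h)$, such that, for some $\phi=\Omega(1/\log n)$: (1) each $K\in\mathcal F$ is a $\phi$-expander with $\deg_K(u)\ge\phi h/3$ for all $u\in V(K)$; moreover, $K$ has diameter $O((\log n)/\phi)$ and is $(\phi h/3)$-edge-connected; (2) for each vertex $u\notin\bigcup_{K\in\mathcal F}V(K)$, there are at least $2h/3$ edge-disjoint paths, each of length $O(\log n)$, from $u$ to vertices in $\bigcup_{K\in\mathcal F}V(K)$.
   Context: For $S\subseteq V(K)$, $\delta_K(S)$ is the number of edges of $K$ with exactly one endpoint in $S$, and $\mathrm{vol}_K(S)=\sum_{v\in S}\deg_K(v)$. $K$ is a $\phi$-expander if for every $S$ with $1\le|S|<|V(K)|$, $\delta_K(S)/\min\{\mathrm{vol}_K(S),\mathrm{vol}_K(V(K)\setminus S)\}\ge\phi$. Path length is the number of edges. *)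

(* Defs.v *)
From mathcomp Require Import all_boot all_order all_algebra.
From mathcomp Require Import classical_sets reals ereal constructive_ereal.
From mathcomp Require Import finset.

Set Implicit Arguments.
Unset Strict Implicit.
Unset Printing Implicit Defensive.

Import Order.TTheory GRing.Theory Num.Theory.

Local Open Scope ring_scope.

(* finset is imported last: its trivIset, cover, set0 shadow the homonyms of
   classical_sets. *)

Record sgraph := SGraph {
  vertex :> finType;
  adj : rel vertex;
  adj_sym : symmetric adj;
  adj_irrefl : irreflexive adj }.

Definition edges (G : sgraph) : {set {set G}} :=
  [set [set xy.1; xy.2] | xy : G * G & adj xy.1 xy.2].

Definition deg (G : sgraph) (v : G) : nat := #|[set u | adj v u]|.

Section Induced.
Variables (G : sgraph) (S : {set G}).

Definition induced_adj : rel {x : G | x \in S} :=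
  fun x y => adj (val x) (val y).

Lemma induced_adj_sym : symmetric induced_adj.
Proof. by move=> x y; apply: adj_sym. Qed.

Lemma induced_adj_irrefl : irreflexive induced_adj.
Proof. by move=> x; apply: adj_irrefl. Qed.

Definition induced : sgraph := SGraph induced_adj_sym induced_adj_irrefl.
End Induced.

Definition boundary (G : sgraph) (S : {set G}) : nat :=
  #|[set A in edges G | #|A :&: S| == 1%N]|.

Definition vol (G : sgraph) (S : {set G}) : nat := (\sum_(v in S) deg v)%N.

(* If the denominator is 0 the quotient is 0, so for phi > 0 a graph with at
   least two vertices one of which is isolated is not a phi-expander. *)
Definition expander (R : realType) (phi : R) (G : sgraph) : Prop :=
  forall S : {set G}, (1 <= #|S| < #|G|)%N ->
    phi <= (boundary S)%:R / (minn (vol S) (vol (~: S)))%:R.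

(* The path visits x, then the vertices of p in order: it has size p edges. *)
Definition simple_path (G : sgraph) (x : G) (p : seq G) : bool :=
  path (@adj G) x p && uniq (x :: p).

Definition path_edges (G : sgraph) (x : G) (p : seq G) : seq {set G} :=
  pairmap (fun a b => [set a; b]) x p.

(* +oo if x and y are in different components. *)
Definition dist (R : realType) (G : sgraph) (x y : G) : \bar R :=
  ereal_inf [set ((size p)%:R%:E : \bar R) |
             p in [set p | simple_path x p /\ last x p = y]]%classic.

Definition diam (R : realType) (G : sgraph) : \bar R :=
  ereal_sup [set dist R xy.1 xy.2 | xy in [set: G * G]]%classic.

Definition connected_without (G : sgraph) (D : {set {set G}}) : Prop :=
  forall x y : G,
    connect (fun a b => adj a b && ([set a; b] \notin D)) x y.

(* k is real: this is ceil(k)-edge-connectivity. *)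
Definition edge_connected (R : realType) (k : R) (G : sgraph) : Prop :=
  (1 < #|G|)%N /\
  forall D : {set {set G}}, D \subset edges G -> #|D|%:R < k ->
    connected_without D.

(* No edge occurs on two paths at distinct positions of P; the paths may share
   vertices, including their final ones. *)
Definition edge_disjoint (G : sgraph) (x : G) (P : seq (seq G)) : bool :=
  pairwise (fun p q => [disjoint path_edges x p & path_edges x q]) P.

(* Main.v *)
Require Import Defs.
From mathcomp Require Import all_boot all_order all_algebra.
From mathcomp Require Import reals ereal constructive_ereal exp.
From mathcomp Require Import ring lra zify.

(** A vertex set S maximising e(S) / (|S| (1 + ln |S| / ln n)) among its
    subsets induces an Omega(1 / log n)-expander: if a cut of S were sparse, one
    of its sides would have a larger value. Removing a single vertex shows that
    the minimum degree of H[S] is a constant fraction of its average degree, and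
    this makes every cut of H[S] contain Omega(h / log n) edges.

    Let F be a maximal family of disjoint such sets with average degree
    Omega(h). No subset X of the uncovered set B contains one, so every
    X has few internal edges compared with its volume in H. Hence the vertices of
    X with more than a third of their neighbours in X carry at most half of the
    volume of X, and repeatedly peeling off the other ones exhausts B in
    O(log n) rounds. In the resulting layering each vertex of B has at least
    twice as many edges going to earlier layers or cores as to later layers.
    Pairing incoming with outgoing edges injectively at each vertex continues
    the outgoing edges of u to edge-disjoint paths that descend to the cores. *)

Set Implicit Arguments.
Unset Strict Implicit.
Unset Printing Implicit Defensive.

Import Order.TTheory GRing.Theory Num.Theory.

Local Open Scope ring_scope.

(** * Edges between vertex sets *)

Section Cross.
Local Open Scope nat_scope.
Variable G : sgraph.
Implicit Types (v : G) (X Y Z : {set G}).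

(* Counts ordered pairs, so [cross X X] is twice the number of edges inside
   [X]. *)
Definition cross X Y : nat := \sum_(x in X) \sum_(y in Y) adj x y.

Lemma crossC X Y : cross X Y = cross Y X.
Proof.
rewrite /cross exchange_big /=.
by apply: eq_bigr => y _; apply: eq_bigr => x _; rewrite adj_sym.
Qed.

Lemma cross_splitl X Y Z : X \subset Y ->
  cross Y Z = cross X Z + cross (Y :\: X) Z.
Proof. by move=> /setIidPr sXY; rewrite /cross (big_setID X) /= sXY. Qed.

Lemma cross_splitr X Y Z : X \subset Y ->
  cross Z Y = cross Z X + cross Z (Y :\: X).
Proof. by move=> sXY; rewrite crossC (cross_splitl _ sXY) !(crossC Z). Qed.

Lemma cross_split X Y : X \subset Y ->
  cross Y Y = cross X X + cross (Y :\: X) (Y :\: X) + 2 * cross X (Y :\: X).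
Proof.
move=> sXY; rewrite (cross_splitl _ sXY) !(cross_splitr _ sXY).
by rewrite (crossC (Y :\: X) X); lia.
Qed.

Lemma cross_monor X Y Z : X \subset Y -> cross Z X <= cross Z Y.
Proof. by move=> sXY; rewrite (cross_splitr _ sXY) leq_addr. Qed.

Lemma cross1 v X : cross [set v] X = #|[set w in X | adj v w]|.
Proof.
rewrite /cross big_set1 -big_mkcondr /= sum1_card.
by apply: eq_card => w; rewrite !inE.
Qed.

Lemma cross1_le v X : cross [set v] X <= #|X|.
Proof. by rewrite cross1 subset_leq_card //; apply/subsetP => w /[!inE]/andP[]. Qed.

Lemma crossE X Y : cross X Y = \sum_(x in X) cross [set x] Y.
Proof. by apply: eq_bigr => x _; rewrite /cross big_set1. Qed.

Lemma cross_le_mul X Y : cross X Y <= #|X| * #|Y|.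
Proof.
rewrite crossE -sum_nat_const; apply: leq_sum => x _; exact: cross1_le.
Qed.

Lemma cross_self1 v : cross [set v] [set v] = 0.
Proof. by rewrite /cross !big_set1 adj_irrefl. Qed.

Lemma deg_cross v : deg v = cross [set v] [set: G].
Proof. by rewrite cross1; apply: eq_card => w; rewrite !inE. Qed.

Lemma vol_cross X : vol X = cross X [set: G].
Proof. by rewrite crossE; apply: eq_bigr => x _; rewrite deg_cross. Qed.

Lemma vol_mono X Y : X \subset Y -> vol X <= vol Y.
Proof. by move=> sXY; rewrite !vol_cross !(crossC _ setT) cross_monor. Qed.

Lemma vol_le X : vol X <= #|G| ^ 2.
Proof.
rewrite vol_cross (leq_trans (cross_le_mul _ _)) //.
by rewrite -mulnn leq_mul // ?cardsT ?max_card.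
Qed.

Lemma vol_setC X : vol X + vol (~: X) = vol [set: G].
Proof. by rewrite !vol_cross (cross_splitl _ (subsetT X)) setTD. Qed.

Definition crossing_edges X : {set {set G}} :=
  [set A in edges G | #|A :&: X| == 1].

Lemma crossing_edge X (x y : G) : x \in X -> y \notin X -> adj x y ->
  [set x; y] \in crossing_edges X.
Proof.
move=> xX yX xy; rewrite inE; apply/andP; split.
  by apply/imsetP; exists (x, y) => //=; rewrite inE.
rewrite (_ : _ :&: X = [set x]) ?cards1 //; apply/setP => z; rewrite !inE.
case: eqVneq => [-> //=|_]; case: eqVneq => //= ->; exact/negbTE.
Qed.

(** A crossing edge has exactly one endpoint in [X], so the ordered pair starting there is recovered
    from the unordered one. *)
Lemma cross_le_boundary X : cross X (~: X) <= boundary X.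
Proof.
rewrite -[boundary X]/#|crossing_edges X|.
pose E := [set e : G * G | [&& e.1 \in X, e.2 \notin X & adj e.1 e.2]].
have -> : cross X (~: X) = #|E|.
  rewrite /cross pair_big_dep /= -big_mkcondr /= sum1_card.
  by apply: eq_card => -[x y]; rewrite [RHS]inE [LHS]unfold_in /= inE andbA.
rewrite -(@card_in_imset _ _ (fun e => [set e.1; e.2])).
  apply/subset_leq_card/subsetP => A /imsetP[[x y] + ->].
  rewrite inE => /and3P[xX yX xy]; exact: crossing_edge.
move=> [x y] [x' y'] /[!inE] /= /and3P[xX yX xy] /and3P[xX' yX' xy'] eqA.
have : x \in [set x'; y'] by rewrite -eqA !inE eqxx.
have : y \in [set x'; y'] by rewrite -eqA !inE eqxx orbT.
rewrite !inE => /orP[/eqP y_x'|/eqP ->]; first by rewrite y_x' xX' in yX.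
by move=> /orP[/eqP -> //|/eqP x_y']; rewrite x_y' in xX; rewrite xX in yX'.
Qed.

End Cross.

(** * Edge counts in induced subgraphs *)

Section InducedCross.
Variables (G : sgraph) (S : {set G}).
Implicit Types (A B : {set induced S}).

Definition lift_set A : {set G} := [set val x | x in A].

Lemma cross_lift A B : cross A B = cross (lift_set A) (lift_set B).
Proof.
rewrite /cross big_imset /=; last by move=> ? ? _ _; exact: val_inj.
apply: eq_bigr => x _; rewrite big_imset //=.
by move=> ? ? _ _; exact: val_inj.
Qed.

Lemma mem_lift A (x : induced S) : (val x \in lift_set A) = (x \in A).
Proof. by rewrite mem_imset //; exact: val_inj. Qed.

Lemma lift_sub A : lift_set A \subset S.
Proof. by apply/subsetP => _ /imsetP[x _ ->]; exact: (valP x). Qed.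

Lemma lift_setC A : lift_set (~: A) = S :\: lift_set A.
Proof.
apply/setP => x; rewrite inE; case: (boolP (x \in S)) => xS.
  have -> : x = val (exist (fun y => y \in S) x xS : induced S) by [].
  by rewrite !mem_lift inE andbT.
by rewrite andbF; apply/negP => /(subsetP (lift_sub _)); exact/negP.
Qed.

Lemma lift_setT : lift_set setT = S.
Proof.
rewrite -setC0 lift_setC (_ : lift_set set0 = set0) ?setD0 //.
exact: imset0.
Qed.

Lemma card_lift A : #|lift_set A| = #|A|.
Proof. by apply: card_imset; exact: val_inj. Qed.

Lemma lift_set1 (x : induced S) : lift_set [set x] = [set val x].
Proof. exact: imset_set1. Qed.

Lemma card_induced : #|induced S| = #|S|.
Proof. by rewrite -cardsT -card_lift lift_setT. Qed.

End InducedCross.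

(** * Edge-disjoint descending paths *)

Section Routing.
Local Open Scope nat_scope.

(** List [A] before its complement, list [B] before its complement, and match equal positions.
    Injectivity on all of [T], not only on [A], makes [next] injective without side conditions. *)
Lemma injection_extension (T : finType) (A B : {set T}) : #|A| <= #|B| ->
  exists2 f : T -> T, injective f & {in A, forall x, f x \in B}.
Proof.
move=> leAB; pose s (C : {set T}) := enum C ++ enum (~: C).
have s_full C x : x \in s C by rewrite mem_cat !mem_enum inE orbN.
have s_size C : size (s C) = #|T| by rewrite size_cat -!cardE cardsC.
have s_uniq C : uniq (s C).
  rewrite cat_uniq !enum_uniq /= andbT; apply/hasPn => x.
  by rewrite !mem_enum inE.
have idx x : index x (s A) < #|T| by rewrite -(s_size A) index_mem.
exists (fun x => nth x (s B) (index x (s A))).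
  move=> x y; rewrite (set_nth_default x y) ?s_size //.
  by move=> /eqP; rewrite nth_uniq ?s_size // => /eqP/(index_inj x); apply.
move=> x xA.
have ix : index x (s A) < #|A| by rewrite index_cat mem_enum xA cardE index_mem mem_enum.
by rewrite nth_cat -cardE (leq_trans ix leAB) -mem_enum mem_nth // -cardE (leq_trans ix).
Qed.

Variables (G : sgraph) (r : G -> nat).

Definition out_nbrs v := [set w | adj v w && (r w < r v)].
Definition in_nbrs v := [set w | adj v w && (r v < r w)].

(* A trail leaving [v] for [w] continues with the out-edge of [w] that the
   injection [sigma w] from in-edges to out-edges pairs with the edge [vw].
   Since [sigma w] is injective, a directed edge determines its predecessor,
   so trails that share an edge can be traced back to a common start. *)
Variable sigma : G -> G -> G.
Hypothesis sigma_inj : forall v, injective (sigma v).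
Hypothesis sigma_out : forall v, 0 < r v ->
  {in in_nbrs v, forall w, sigma v w \in out_nbrs v}.

Definition next (e : G * G) := (e.2, sigma e.2 e.1).

Lemma next_inj : injective next.
Proof. by move=> [a b] [c d] [<-] /sigma_inj ->. Qed.

Definition down (e : G * G) := adj e.1 e.2 && (r e.2 < r e.1).

Lemma down_next e : down e -> 0 < r e.2 -> down (next e).
Proof.
move=> /andP[ae re] r2; have := sigma_out r2 (x := e.1).
by rewrite !inE adj_sym ae re => /(_ isT).
Qed.

(** [k] is fuel: ranks fall along the trail, so any [k] at least the rank of [e.2] lets it reach
    rank 0. *)
Fixpoint trail k e : seq G :=
  e.2 :: if k is k'.+1 then
           if r e.2 == 0 then [::] else trail k' (next e)
         else [::].

(** The last clause places each trail edge in the [next]-orbit of [e], with all earlier edges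
    descending, as tracing back requires. *)
Lemma trailP k e : down e -> r e.2 <= k ->
  [/\ path (fun a b => down (a, b)) e.1 (trail k e),
      r (last e.1 (trail k e)) = 0, size (trail k e) <= (r e.2).+1
    & forall A, A \in path_edges e.1 (trail k e) -> exists2 i,
        forall j, j <= i -> down (iter j next e) &
        A = [set (iter i next e).1; (iter i next e).2]].
Proof.
have base e' : down e' -> forall j, j <= 0 -> down (iter j next e').
  by move=> de' j; rewrite leqn0 => /eqP ->.
elim: k e => [|k IHk] e de /=.
  rewrite leqn0 => /eqP re; split => //.
  - by rewrite -surjective_pairing de.
  - by move=> A; rewrite inE => /eqP ->; exists 0 => //; exact: base.
case: ifP => [/eqP re _ /=|re rk].
  split => //; first by rewrite -surjective_pairing de.
  by move=> A; rewrite inE => /eqP ->; exists 0 => //; exact: base.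
have dn : down (next e) by apply: down_next; rewrite // lt0n re.
have rn : r (next e).2 < r e.2 by case/andP: dn.
have [] := IHk (next e) dn; first by rewrite -ltnS (leq_trans rn).
move=> pth lst sz edg; split.
- by rewrite /= -surjective_pairing de.
- by rewrite -lst; case: (k).
- by rewrite ltnS (leq_trans sz).
- move=> A; rewrite /path_edges /= inE => /orP[/eqP ->|].
    by exists 0 => //; exact: base.
  move=> /edg[i di ->]; exists i.+1; last by rewrite iterSr.
  by case=> // j ji; rewrite iterSr; exact: di.
Qed.

(** The fall in rank fixes the orientation of an edge. *)
Lemma down_edge_inj e f : down e -> down f ->
  [set e.1; e.2] = [set f.1; f.2] -> e = f.
Proof.
case: e f => [a b] [c d] /andP[/= _ ab] /andP[/= _ cd] E.
have : a \in [set c; d] by rewrite -E !inE eqxx.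
have : b \in [set c; d] by rewrite -E !inE eqxx orbT.
rewrite !inE => /orP[]/eqP eb /orP[]/eqP ea; subst => //; lia.
Qed.

Lemma rank_iter_next e i : (forall j, j <= i -> down (iter j next e)) ->
  0 < i -> r (iter i next e).1 < r e.1.
Proof.
elim: i => // -[_ di _|i IHi di _]; first by case/andP: (di 0 isT).
apply: ltn_trans (IHi _ _) => //; last by move=> j ji; apply: di; lia.
by rewrite iterS /=; case/andP: (di i.+1 (leqnSn _)).
Qed.

(** Cancelling [i] steps makes [e] an iterate of [f]. A proper iterate would start at rank strictly
    below that of [f.1], which is [e.1]. *)
Lemma iter_next_eq e f i j : e.1 = f.1 ->
  (forall m, m <= j -> down (iter m next f)) -> i <= j ->
  iter i next e = iter j next f -> e = f.
Proof.
move=> ef df ij; rewrite -(subnKC ij) iterD.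
have inj_iter : injective (iter i next).
  by elim: (i) => //= m IHm x y /next_inj/IHm.
move=> /inj_iter E; case: (posnP (j - i)) => [m0|m_gt0].
  by rewrite E m0.
suff: false by []; have := @rank_iter_next f (j - i).
rewrite -E ef ltnn; apply => // m mji.
by apply: df; lia.
Qed.

End Routing.

Lemma edge_disjoint_descent (G : sgraph) (r : G -> nat) (u : G) :
  (forall v, (0 < r v)%N -> (#|in_nbrs r v| <= #|out_nbrs r v|)%N) ->
  exists P : seq (seq G),
    [/\ size P = #|out_nbrs r u|, edge_disjoint u P
      & forall p, p \in P ->
          [/\ simple_path u p, r (last u p) = 0%N & (size p <= r u)%N]].
Proof.
move=> balanced.
pose extends v (f : {ffun G -> G}) := injectiveb f &&
  ((0 < r v)%N ==> [forall w in in_nbrs r v, f w \in out_nbrs r v]).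
have ex_sigma v : exists f, extends v f.
  have [rv|rv] := posnP (r v).
    exists [ffun x => x]; rewrite /extends rv /= andbT.
    by apply/injectiveP => x y; rewrite !ffunE.
  have [f f_inj f_out] := injection_extension (balanced v rv).
  exists (finfun f); apply/andP; split.
    by apply/injectiveP => x y; rewrite !ffunE => /f_inj.
  apply/implyP => _; apply/forall_inP => w wv; rewrite ffunE; exact: f_out.
pose sigma v : G -> G := xchoose (ex_sigma v).
have sigma_inj v : injective (sigma v).
  by have /andP[/injectiveP] := xchooseP (ex_sigma v).
have sigma_out v : (0 < r v)%N ->
    {in in_nbrs r v, forall w, sigma v w \in out_nbrs r v}.
  move=> rv; have /andP[_] := xchooseP (ex_sigma v).
  by move=> /implyP/(_ rv)/forall_inP.
pose route w := trail r sigma (r w) (u, w).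
exists [seq route w | w in out_nbrs r u].
have down_start w : w \in out_nbrs r u -> down r (u, w) by rewrite inE.
split.
- by rewrite size_map cardE.
- rewrite /edge_disjoint pairwise_map.
  apply: (@sub_in_pairwise _ [in out_nbrs r u] (fun x y => x != y)).
  + move=> w w' wu wu' /= ww'.
    have [_ _ _ Ew] := trailP sigma_out (down_start w wu) (leqnn _).
    have [_ _ _ Ew'] := trailP sigma_out (down_start w' wu') (leqnn _).
    rewrite disjoint_subset; apply/subsetP => A /Ew[i di ->].
    rewrite !inE; apply/negP => /Ew'[j dj E].
    have Eij := down_edge_inj (di i (leqnn _)) (dj j (leqnn _)) E.
    case/eqP: ww'; case: (leqP i j) => ij.
      by have [] := iter_next_eq sigma_inj (e := (u, w)) (f := (u, w')) erefl dj ij Eij.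
    by have [] := iter_next_eq sigma_inj (e := (u, w')) (f := (u, w)) erefl di (ltnW ij) (esym Eij).
  + by apply/allP => w; rewrite mem_enum.
  + by rewrite -uniq_pairwise enum_uniq.
- move=> p /mapP[w]; rewrite mem_enum => wu ->.
  have [pth lst sz _] := trailP sigma_out (down_start w wu) (leqnn _).
  split => //.
  + apply/andP; split; first by apply: sub_path pth => a b /andP[].
    (* Strictly falling ranks forbid repeated vertices. *)
    apply: (@sorted_uniq _ (fun a b => r b < r a)%N).
    * by move=> b a c ab bc; exact: ltn_trans bc ab.
    * by move=> a; exact: ltnn.
    * by apply: sub_path pth => a b /andP[].
  + by apply: leq_trans sz _; case/andP: (down_start w wu).
Qed.

(** * Peeling sparse sets *)

Section Layers.
Local Open Scope nat_scope.
Variables (G : sgraph) (B : {set G}).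

(** The survivors of one round; the other vertices of [X] are the ones peeled off. *)
Definition peel (X : {set G}) := [set v in X | deg v < 3 * cross [set v] X].

Definition layer i := iter i peel B.

Lemma layerS_sub i : layer i.+1 \subset layer i.
Proof. by apply/subsetP => v; rewrite /layer iterS inE => /andP[]. Qed.

Lemma layer_sub i j : i <= j -> layer j \subset layer i.
Proof.
move=> /subnKC <-; elim: (j - i) => [|m IHm]; first by rewrite addn0.
by rewrite addnS (subset_trans (layerS_sub _)).
Qed.

Hypothesis sparse : forall X : {set G}, X \subset B -> 6 * cross X X <= vol X.

(** Summing the survival condition over the survivors bounds their volume by [3 * cross X X], which
    sparsity makes at most half of [vol X]. *)
Lemma vol_peel (X : {set G}) : X \subset B -> 2 * vol (peel X) <= vol X.
Proof.
move=> /sparse spX; have peelX : peel X \subset X.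
  by apply/subsetP => v; rewrite inE => /andP[].
suff : vol (peel X) <= 3 * cross X X by lia.
rewrite (cross_splitl _ peelX) crossE mulnDr (leq_trans _ (leq_addr _ _)) //.
rewrite big_distrr; apply: leq_sum => v; rewrite inE => /andP[_]; exact: ltnW.
Qed.

Lemma vol_layer i : 2 ^ i * vol (layer i) <= vol B.
Proof.
elim: i => [|i IHi]; first by rewrite mul1n.
apply: leq_trans IHi; rewrite expnSr -mulnA leq_mul2l vol_peel ?orbT //.
exact: layer_sub (leq0n i).
Qed.

Hypothesis deg_gt0 : forall v : G, 0 < deg v.

Lemma card_le_vol (X : {set G}) : #|X| <= vol X.
Proof. by rewrite -sum1_card; apply: leq_sum => v _; exact: deg_gt0. Qed.

Variable k : nat.
Hypothesis k_large : #|G| ^ 2 < 2 ^ k.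

(** Each round halves a volume that is at most [#|G| ^ 2] initially, so it drops below 1, while any
    vertex left contributes at least 1. *)
Lemma layer_empty : layer k = set0.
Proof.
apply/eqP; rewrite -cards_eq0 -leqn0; have := vol_layer k.
have := vol_le B; have := card_le_vol (layer k).
by case: #|layer k| => // m; nia.
Qed.

Lemma leaves_layer v : exists i, v \notin layer i.
Proof. by exists k; rewrite layer_empty inE. Qed.

(** Rank 0 means outside [B]; otherwise the rank is the number of the round that removes [v]. *)
Definition rank v := ex_minn (leaves_layer v).

Lemma rank_le v i : (rank v <= i) = (v \notin layer i).
Proof.
rewrite /rank; case: ex_minnP => j vj minj; apply/idP/idP; last exact: minj.
by move=> ji; apply: contra vj => /(subsetP (layer_sub ji)).
Qed.

(** A vertex of rank [i.+1] fails the survival test in [layer i], so at most a third of its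
    neighbours lie there. All its in-neighbours do, and its out-neighbours are exactly the rest. *)
Lemma rank_nbrs v : 0 < rank v ->
  #|in_nbrs rank v| <= #|out_nbrs rank v| /\ 2 * deg v <= 3 * #|out_nbrs rank v|.
Proof.
case rk: (rank v) => [//|i] _.
have vi : v \in layer i by rewrite -[_ \in _]negbK -rank_le rk ltnn.
have : v \notin layer i.+1 by rewrite -rank_le rk.
rewrite /layer iterS inE vi /= -leqNgt -/(layer i) => inner.
have outE : #|out_nbrs rank v| = cross [set v] (~: layer i).
  by rewrite cross1; apply: eq_card => w; rewrite !inE rk ltnS rank_le andbC.
have inE' : #|in_nbrs rank v| <= cross [set v] (layer i).
  rewrite cross1; apply/subset_leq_card/subsetP => w; rewrite !inE rk.
  move=> /andP[-> rw]; rewrite andbT -[_ \in _]negbK -rank_le; lia.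
have := deg_cross v; rewrite (cross_splitr _ (subsetT (layer i))) setTD -outE.
lia.
Qed.

Lemma sparse_routing u : u \in B ->
  exists P : seq (seq G),
    [/\ 2 * deg u <= 3 * size P, edge_disjoint u P
      & forall p, p \in P ->
          [/\ simple_path u p, last u p \notin B & size p <= k]].
Proof.
move=> uB; have [//|P [sizeP disjP simpleP]] := @edge_disjoint_descent G rank u.
  by move=> v /rank_nbrs[].
have ru : 0 < rank u by rewrite lt0n -leqn0 rank_le negbK.
exists P; split=> //; first by rewrite sizeP; case: (rank_nbrs ru).
move=> p /simpleP[simp lst sz]; split=> //.
  by have := rank_le (last u p) 0; rewrite lst => <-.
by apply: leq_trans sz _; rewrite rank_le layer_empty inE.
Qed.

End Layers.

(** * Logarithmic estimates and the superlinear weight *)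

Section LnEstimates.
Variable R : realType.
Implicit Types (x : R) (a b m n : nat).

Lemma ln2_gt0 : 0 < ln 2 :> R.
Proof. by rewrite ln_gt0 // ltr1n. Qed.

Lemma ler_ln_nat a b : (0 < a)%N -> (a <= b)%N -> ln a%:R <= ln b%:R :> R.
Proof. by move=> a0 ab; rewrite ler_ln ?posrE ?ltr0n ?ler_nat //; lia. Qed.

(** Apply [ln (1 + y) <= y] at [y = - (x / (1 + x))], where [1 + y] is the inverse of [1 + x]. *)
Lemma half_le_ln1D x : 0 <= x <= 1 -> x / 2 <= ln (1 + x).
Proof.
move=> /andP[x0 x1]; have x1_gt0 : 0 < 1 + x by lra.
have := @le_ln1Dx R (- (x / (1 + x))); rewrite ltrN2 ltr_pdivrMr //.
have -> : 1 - x / (1 + x) = (1 + x)^-1 by field; lra.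
rewrite lnV ?posrE // lerN2 => H; apply: le_trans (H _); last by lra.
by rewrite ler_pdivlMr //; nra.
Qed.

(** The 3 is 2 from the square plus 1 for rounding up, since [ln 2 <= ln n]. *)
Lemma log2_sq_bound n : (1 < n)%N ->
  exists2 k, (n ^ 2 < 2 ^ k)%N & k%:R <= 3 / ln 2 * ln n%:R :> R.
Proof.
move=> n1; exists (trunc_log 2 (n ^ 2)).+1; first exact: trunc_log_ltn.
have kn : (2 ^ trunc_log 2 (n ^ 2) <= n ^ 2)%N.
  by rewrite trunc_logP // expn_gt0 (ltnW n1).
set k := trunc_log _ _ in kn *.
have knR : k%:R * ln 2 <= 2 * ln n%:R :> R.
  have n0 : 0 < n%:R :> R by rewrite ltr0n ltnW.
  rewrite mulr_natl -lnXn // mulr_natl -lnXn // -(natrX _ 2 k) -(natrX _ n 2).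
  by rewrite ler_ln_nat // expn_gt0.
have := ler_ln_nat (isT : (0 < 2)%N) n1; have := ln2_gt0.
move=> l2 ln; rewrite mulrAC ler_pdivlMr // -natr1; lra.
Qed.

(** The factor on [m] only rises from 1 to 2 over [1 <= m <= n], yet a union outweighs its two parts
    by an [ln 2 / ln n] fraction of the smaller one. *)
Definition weight n m : R := m%:R * (1 + ln m%:R / ln n%:R).

Variable n : nat.
Hypothesis n_gt1 : (1 < n)%N.

Lemma lnn_ge : ln 2 <= ln n%:R :> R.
Proof. exact: ler_ln_nat. Qed.

Lemma lnn_gt0 : 0 < ln n%:R :> R.
Proof. exact: lt_le_trans ln2_gt0 lnn_ge. Qed.

Lemma weight_bounds m : (0 < m <= n)%N -> m%:R <= weight n m <= 2 * m%:R.
Proof.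
move=> /andP[m0 mn]; have m0R : 0 <= m%:R :> R by rewrite ler0n.
have r0 : 0 <= ln m%:R / ln n%:R :> R.
  by rewrite divr_ge0 // ?(ltW lnn_gt0) // ln_ge0 // ler1n.
have r1 : ln m%:R / ln n%:R <= 1 :> R.
  by rewrite ler_pdivrMr ?lnn_gt0 // mul1r ler_ln_nat.
by rewrite /weight; apply/andP; split; nra.
Qed.

Lemma weight_gt0 m : (0 < m <= n)%N -> 0 < weight n m.
Proof.
move=> mn; have /andP[+ _] := weight_bounds mn; apply: lt_le_trans.
by rewrite ltr0n; case/andP: mn.
Qed.

(** In the union the logarithm attached to the smaller part [a] grows by at least [ln 2], as the
    size at least doubles; the other logarithm does not shrink. *)
Lemma weightD a b : (0 < a <= b)%N ->
  weight n a + weight n b + a%:R * (ln 2 / ln n%:R) <= weight n (a + b).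
Proof.
move=> /andP[a0 ab]; have l0 := lnn_gt0.
have la : ln 2 + ln a%:R <= ln (a + b)%:R :> R.
  by rewrite -lnM ?posrE ?ltr0n // -natrM ler_ln_nat //; lia.
have lb : ln b%:R <= ln (a + b)%:R :> R by rewrite ler_ln_nat //; lia.
have a0R : 0 <= a%:R :> R by rewrite ler0n.
have b0R : 0 <= b%:R :> R by rewrite ler0n.
rewrite /weight natrD -(ler_pM2r l0).
have -> : (a%:R * (1 + ln a%:R / ln n%:R) + b%:R * (1 + ln b%:R / ln n%:R) +
    a%:R * (ln 2 / ln n%:R)) * ln n%:R =
  (a%:R + b%:R) * ln n%:R + a%:R * (ln 2 + ln a%:R) + b%:R * ln b%:R :> R.
  by field; lra.
have -> : (a%:R + b%:R) * (1 + ln (a%:R + b%:R) / ln n%:R) * ln n%:R =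
  (a%:R + b%:R) * ln n%:R + a%:R * ln (a%:R + b%:R) + b%:R * ln (a%:R + b%:R) :> R.
  by field; lra.
rewrite -natrD; nra.
Qed.

End LnEstimates.

(** * Expanding cores *)

Section Core.
Variables (R : realType) (G : sgraph) (h : R).
Implicit Types X S B : {set G}.

(* [S] has maximal average degree after normalisation by the slightly
   superlinear [weight]; the surplus of [weight] on a union is what forces many
   edges across every cut of [S]. *)
Definition is_core S : bool :=
  [&& S != set0,
      h / 12 * weight R #|G| #|S| <= (cross S S)%:R
    & [forall X : {set G}, (X \subset S) && (X != set0) ==>
        ((cross X X)%:R / weight R #|G| #|X| <=
         (cross S S)%:R / weight R #|G| #|S|)]].

Hypothesis G_gt1 : (1 < #|G|)%N.

Lemma card_bounds X : X != set0 -> (0 < #|X| <= #|G|)%N.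
Proof. by rewrite card_gt0 max_card => ->. Qed.

(** A densest subset of [B] is at least as dense as [B] itself, and the bound of [weight] by
    [2 * #|B|] turns 1/6 into the 1/12 of [is_core]. *)
Lemma core_exists B : 0 <= h -> B != set0 ->
  h * #|B|%:R <= 6 * (cross B B)%:R -> exists2 S, is_core S & S \subset B.
Proof.
move=> h0 B0 hB.
pose density X : R := (cross X X)%:R / weight R #|G| #|X|.
have [|S /andP[sSB S0] Smax] :=
  @arg_maxP _ _ _ B (fun X => (X \subset B) && (X != set0)) density.
  by rewrite subxx.
exists S => //; apply/and3P; split => //.
  rewrite -ler_pdivlMr ?weight_gt0 ?card_bounds //.
  apply: le_trans (Smax B _); last by rewrite subxx.
  rewrite /density ler_pdivlMr ?weight_gt0 ?card_bounds //.
  by have /andP[_] := weight_bounds R G_gt1 (card_bounds B0); nra.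
apply/forallP => X; apply/implyP => /andP[XS X0]; apply: Smax.
by rewrite X0 (subset_trans XS).
Qed.

Hypothesis h_gt0 : 0 < h.
Variable S : {set G}.
Hypothesis coreS : is_core S.

Let lam : R := (cross S S)%:R / weight R #|G| #|S|.

Let S_neq0 : S != set0. Proof. by case/and3P: coreS. Qed.

Let crossSS : (cross S S)%:R = lam * weight R #|G| #|S|.
Proof. by rewrite divfK // gt_eqF // weight_gt0 // card_bounds. Qed.

Let lam_ge : h / 12 <= lam.
Proof. by rewrite ler_pdivlMr ?weight_gt0 ?card_bounds //; case/and3P: coreS. Qed.

Let lam_gt0 : 0 < lam.
Proof. by rewrite (lt_le_trans _ lam_ge) // divr_gt0. Qed.

Let lam_max X : X \subset S -> X != set0 ->
  (cross X X)%:R <= lam * weight R #|G| #|X|.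
Proof.
move=> XS X0; rewrite -ler_pdivrMr ?weight_gt0 ?card_bounds //.
by case/and3P: coreS => _ _ /forallP/(_ X); rewrite XS X0.
Qed.

Lemma core_card : (1 < #|S|)%N.
Proof.
have /andP[S0 _] := card_bounds S_neq0.
rewrite ltn_neqAle S0 andbT; apply/negP => /eqP/esym/eqP/cards1P[v Sv].
have := mulr_gt0 lam_gt0 (weight_gt0 R G_gt1 (card_bounds S_neq0)).
by rewrite -crossSS Sv cross_self1 ltxx.
Qed.

(** Split [cross S S] along the cut and bound both inner terms by maximality; the remainder must
    cross. *)
Let surplus X : X \subset S -> X != set0 -> (#|X| <= #|S :\: X|)%N ->
  lam * (weight R #|G| #|S| - weight R #|G| #|X| - weight R #|G| #|S :\: X|) <=
  2 * (cross X (S :\: X))%:R.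
Proof.
move=> XS X0 leX; have Y0 : S :\: X != set0.
  by rewrite -card_gt0 (leq_trans _ leX) // card_gt0.
have := lam_max XS X0; have := lam_max (subsetDl S X) Y0.
have := crossSS; rewrite (cross_split XS) 2!natrD natrM; lra.
Qed.

Let cardSD X : X \subset S -> #|S| = (#|X| + #|S :\: X|)%N.
Proof. by move=> XS; rewrite -(cardsID X S) (setIidPr XS). Qed.

(** [[set v]] spans no edge yet adds at least 1 to the weight, so by maximality its edges into [S],
    counted twice, number at least [lam >= h / 12]. *)
Lemma core_deg v : v \in S -> h / 24 <= (cross [set v] S)%:R.
Proof.
move=> vS; have XS : [set v] \subset S by rewrite sub1set.
have := cardSD XS; rewrite cards1 => cS; have S1 := core_card.
have Y0 : S :\: [set v] != set0 by rewrite -card_gt0; lia.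
have := @weightD R _ G_gt1 1 #|S :\: [set v]|; rewrite -cS card_gt0 Y0.
move=> /(_ isT); rewrite {1}/weight ln1 !mul1r mul0r addr0 => wS.
have ln_ge0 : 0 <= ln 2 / ln #|G|%:R :> R.
  by rewrite divr_ge0 // ltW // ?lnn_gt0 // ln2_gt0.
have := lam_max (subsetDl S [set v]) Y0; have := lam_ge; have := lam_gt0.
have : (cross [set v] (S :\: [set v]))%:R <= (cross [set v] S)%:R :> R.
  by rewrite ler_nat cross_monor // subsetDl.
have := crossSS; rewrite (cross_split XS) cross_self1 add0n natrD natrM; nra.
Qed.

(** With [c] crossing edges, [a = #|X|] and [L = ln #|G|], the surplus gives
    [lam * a * ln 2 <= 2 * c * L], and maximality gives [cross X X <= 2 * (lam * a)]. So
    [ln 2 * cross X X <= 4 * c * L]; the crossing edges add one more [c * L], whence the 5. *)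
Let small_side X : X \subset S -> X != set0 -> (#|X| <= #|S :\: X|)%N ->
  ln 2 / (5 * ln #|G|%:R) * (cross X S)%:R <= (cross X (S :\: X))%:R :> R.
Proof.
move=> XS X0 leX; have l2 := ln2_gt0 R; have ln2n := lnn_ge R G_gt1.
have ln_gt0 : 0 < ln #|G|%:R :> R by lra.
have /andP[_ wX] := weight_bounds R G_gt1 (card_bounds X0).
have := weightD R G_gt1 (a := #|X|) (b := #|S :\: X|).
rewrite -cardSD // leX card_gt0 X0 => /(_ isT) wS.
have sur := surplus XS X0 leX; have mX := lam_max XS X0.
set c := (cross X (S :\: X))%:R in sur *; set L := ln #|G|%:R in wS *.
set a := #|X|%:R in wX wS.
have cut : lam * a * ln 2 <= 2 * c * L.
  have : lam * (a * (ln 2 / L)) <= 2 * c.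
    by apply: le_trans sur; rewrite ler_pM2l //; lra.
  by rewrite !mulrA ler_pdivrMr.
have mXa : (cross X X)%:R <= 2 * (lam * a).
  by apply: le_trans mX _; rewrite [leRHS]mulrCA ler_pM2l.
have -> : (cross X S)%:R = (cross X X)%:R + c :> R.
  by rewrite (cross_splitr _ XS) natrD.
have c0 : 0 <= c by rewrite ler0n.
rewrite mulrAC ler_pdivrMr; last by rewrite mulr_gt0.
have : ln 2 * (cross X X)%:R <= ln 2 * (2 * (lam * a)) by rewrite ler_pM2l.
have : ln 2 * c <= L * c by rewrite ler_wpM2r.
lra.
Qed.

Lemma core_expansion X : X \subset S -> X != set0 -> S :\: X != set0 ->
  ln 2 / (5 * ln #|G|%:R) * (minn (cross X S) (cross (S :\: X) S))%:R <=
  (cross X (S :\: X))%:R :> R.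
Proof.
move=> XS X0 Y0; have l2 := ln2_gt0 R; have ln2n := lnn_ge R G_gt1.
have psi0 : 0 <= ln 2 / (5 * ln #|G|%:R) :> R.
  by rewrite divr_ge0 //; lra.
have XD : S :\: (S :\: X) = X by rewrite setDDr setDv set0U (setIidPr XS).
case: (leqP #|X| #|S :\: X|) => leX.
  apply: le_trans (small_side XS X0 leX).
  by rewrite ler_wpM2l // ler_nat geq_minl.
have := small_side (subsetDl S X) Y0; rewrite XD => /(_ (ltnW leX)).
rewrite (crossC (S :\: X) X) => small; apply: le_trans small.
by rewrite ler_wpM2l // ler_nat geq_minr.
Qed.

End Core.

(** * Connectivity and diameter from expansion *)

Section Expansion.
Variables (R : realType) (K : sgraph) (psi d : R).
Hypothesis psi_01 : 0 < psi <= 1.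
Hypothesis d_gt0 : 0 < d.
Hypothesis deg_ge : forall v : K, d <= (deg v)%:R.
Hypothesis K_gt1 : (1 < #|K|)%N.
Hypothesis expansion : forall A : {set K}, A != set0 -> ~: A != set0 ->
  psi * (minn (vol A) (vol (~: A)))%:R <= (cross A (~: A))%:R.
Implicit Types (A : {set K}) (x y z : K).

Lemma vol_ge_deg A : A != set0 -> d <= (vol A)%:R.
Proof.
case/set0Pn=> v vA; apply: le_trans (deg_ge v) _.
by rewrite ler_nat /vol (bigD1 v) //= leq_addr.
Qed.

Lemma vol_gt0 A : A != set0 -> (0 < vol A)%N.
Proof. by move=> A0; rewrite -(ltr0n R) (lt_le_trans d_gt0) ?vol_ge_deg. Qed.

Lemma min_vol_ge A : A != set0 -> ~: A != set0 ->
  d <= (minn (vol A) (vol (~: A)))%:R.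
Proof. by move=> A0 cA0; rewrite /minn; case: ifP => _; exact: vol_ge_deg. Qed.

Lemma boundary_ge A : A != set0 -> ~: A != set0 ->
  psi * (minn (vol A) (vol (~: A)))%:R <= (boundary A)%:R.
Proof.
move=> A0 cA0; apply: le_trans (expansion A0 cA0) _.
by rewrite ler_nat cross_le_boundary.
Qed.

Lemma expansion_expander phi : phi <= psi -> expander phi K.
Proof.
move=> le_phi A /andP[A1 AK].
have A0 : A != set0 by rewrite -card_gt0.
have cA0 : ~: A != set0 by rewrite -card_gt0; have := cardsC A; lia.
rewrite ler_pdivlMr; last exact: lt_le_trans (min_vol_ge A0 cA0).
by apply: le_trans (boundary_ge A0 cA0); rewrite ler_wpM2r.
Qed.

(** If [D] separates [y] from [x], all edges leaving the component [A] of [x] lie in [D], but there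
    are at least [psi * d] of them. *)
Lemma expansion_edge_connected k : k <= psi * d -> edge_connected k K.
Proof.
move=> le_k; split=> // D _ Dk x y; rewrite -[connect _ _ _]negbK.
apply/negP => nxy; pose e a b := adj a b && ([set a; b] \notin D).
pose A := [set z : K | connect e x z].
have A0 : A != set0 by apply/set0Pn; exists x; rewrite inE connect0.
have cA0 : ~: A != set0 by apply/set0Pn; exists y; rewrite !inE.
have AD : crossing_edges A \subset D.
  apply/subsetP => E; rewrite inE => /andP[/imsetP[[a b] + ->]].
  rewrite inE /= => ab; apply: contraLR => nD.
  have conn : (a \in A) = (b \in A).
    rewrite !inE; apply/idP/idP => xa; apply: connect_trans xa (connect1 _).
      by rewrite /e ab.
    by rewrite /e adj_sym ab setUC.
  have [aA|aA] := boolP (a \in A).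
    have/setIidPl -> : [set a; b] \subset A.
      by rewrite subUset !sub1set -conn aA.
    rewrite cards2; suff -> : a != b by [].
    by apply: contraTneq ab => ->; rewrite adj_irrefl.
  rewrite (_ : _ :&: A = set0) ?cards0 //; apply/setP => z; rewrite !inE.
  case: eqVneq => [->|_] /=; first by move: aA; rewrite inE => /negbTE.
  case: eqVneq => [->|//]; move: aA; rewrite conn inE; exact/negbTE.
have : (boundary A)%:R < psi * d.
  by apply: le_lt_trans (lt_le_trans Dk le_k); rewrite ler_nat subset_leq_card.
rewrite ltNge => /negP; apply; apply: le_trans (boundary_ge A0 cA0).
by have /andP[psi0 _] := psi_01; rewrite ler_wpM2l ?min_vol_ge // ltW.
Qed.

Definition reach k x y := exists p : seq K,
  [/\ path (@adj K) x p, last x p = y & (size p <= k)%N].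

Lemma reach_sym k x y : reach k x y -> reach k y x.
Proof.
move=> [p [pth <- sz]]; exists (rev (belast x p)); split.
- by rewrite rev_path (eq_path (e' := @adj K)) // => a b; exact: adj_sym.
- by case: p {pth sz} => //= a p; rewrite rev_cons last_rcons.
- by rewrite size_rev size_belast.
Qed.

Lemma reach_trans k l x y z : reach k x y -> reach l y z -> reach (k + l) x z.
Proof.
move=> [p [pp <- sp]] [q [pq <- sq]]; exists (p ++ q); split.
- by rewrite cat_path pp.
- by rewrite last_cat.
- by rewrite size_cat leq_add.
Qed.

Lemma dist_le k x y : reach k x y -> (dist R x y <= k%:R%:E)%E.
Proof.
move=> [p [pth <- sz]]; case: (shortenP pth) => q pq uq sub.
apply: (@le_trans _ _ (size q)%:R%:E).
  by apply: ereal_inf_lbound; exists q => //; split=> //; rewrite /simple_path pq.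
rewrite lee_fin ler_nat (leq_trans _ sz) // uniq_leq_size //.
by case/andP: uq.
Qed.

Fixpoint gball k x : {set K} :=
  if k is k'.+1 then gball k' x :|: [set y | [exists z in gball k' x, adj z y]]
  else [set x].

Lemma gball_reach k x y : y \in gball k x -> reach k x y.
Proof.
elim: k y => [|k IHk] y /=.
  by rewrite inE => /eqP ->; exists [::].
rewrite !inE => /orP[/IHk[p [pp lp sp]]|]; first by exists p; split=> //; exact: leqW.
case/existsP => z /andP[/IHk xz zy]; rewrite -addn1; apply: reach_trans xz _.
by exists [:: y]; rewrite /= zy.
Qed.

Lemma gball_neq0 k x : gball k x != set0.
Proof.
apply/set0Pn; exists x; elim: k => [|k IHk] /=; first by rewrite inE.
by rewrite inE IHk.
Qed.

(** Every edge leaving the ball ends in the newly added sphere and counts towards its volume. *)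
Lemma vol_gballS k x :
  (vol (gball k x) + cross (gball k x) (~: gball k x) <= vol (gball k.+1 x))%N.
Proof.
set B := gball k x; set B' := gball k.+1 x.
have sBB' : B \subset B' by rewrite /B' /= subsetUl.
rewrite (vol_cross B') (cross_splitl _ sBB') -vol_cross leq_add2l.
have -> : cross B (~: B) = cross B (B' :\: B).
  apply: eq_bigr => z zB; rewrite (bigID [in B']) /= [X in (_ + X)%N]big1 ?addn0.
    by apply: eq_bigl => y; rewrite !inE.
  move=> y /andP[_ yB']; apply/eqP; rewrite eqb0; apply: contra yB' => zy.
  by rewrite inE orbC inE; apply/orP; left; apply/existsP; exists z; rewrite zB.
by rewrite crossC cross_monor ?subsetT.
Qed.

(** While the ball holds at most half of the volume, the minimum in [expansion] is its own volume,
    so each step gains a factor of at least [1 + psi]. *)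
Lemma vol_gball_growth k x : (2 * vol (gball k x) <= vol [set: K])%N ->
  (1 + psi) ^+ k <= (vol (gball k x))%:R.
Proof.
have psi0 : 0 < psi by case/andP: psi_01.
elim: k => [|k IHk] small; first by rewrite expr0 ler1n vol_gt0 ?gball_neq0.
have grow := vol_gballS k x.
have smallk : (2 * vol (gball k x) <= vol [set: K])%N.
  by apply: leq_trans small; rewrite leq_mul2l (leq_trans _ grow) ?leq_addr.
have vC := vol_setC (gball k x).
have B0 := vol_gt0 (gball_neq0 k x).
have cB0 : ~: gball k x != set0.
  by apply/eqP => c0; move: vC smallk; rewrite c0 {2}/vol big_set0; lia.
have := expansion (gball_neq0 k x) cB0; rewrite (minn_idPl _); last lia.
move: grow (IHk smallk); rewrite exprSr -(ler_nat R) natrD => grow ih ex.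
apply: le_trans grow; rewrite mulrDr mulr1.
have : (1 + psi) ^+ k * psi <= (vol (gball k x))%:R * psi by rewrite ler_pM2r.
lra.
Qed.

(** Otherwise [(1 + psi) ^+ k <= #|K|%:R ^+ 2], and [ln (1 + psi) >= psi / 2] gives
    [psi * k <= 4 * ln #|K|]. *)
Lemma vol_gball_half k x : 4 * ln #|K|%:R < psi * k%:R ->
  (vol [set: K] < 2 * vol (gball k x))%N.
Proof.
move=> large; rewrite ltnNge; apply/negP => /vol_gball_growth growth.
have /andP[psi0 psi1] := psi_01.
have K0 : 0 < #|K|%:R :> R by rewrite ltr0n ltnW.
have : (1 + psi) ^+ k <= #|K|%:R ^+ 2.
  by apply: le_trans growth _; rewrite -natrX ler_nat vol_le.
rewrite -ler_ln ?posrE ?exprn_gt0 ?addr_gt0 // !lnXn ?addr_gt0 //.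
have := half_le_ln1D (x := psi); rewrite psi1 (ltW psi0) => /(_ isT) half.
rewrite -[ln (1 + psi) *+ k]mulr_natl -[_ *+ 2]mulr_natl => growth2.
have : k%:R * (psi / 2) <= k%:R * ln (1 + psi) by rewrite ler_wpM2l.
lra.
Qed.

Lemma dist_half_balls k x y : 4 * ln #|K|%:R < psi * k%:R ->
  (dist R x y <= (k + k)%:R%:E)%E.
Proof.
move=> large; have Bx := vol_gball_half x large; have By := vol_gball_half y large.
apply: dist_le; have [disj|] := boolP [disjoint gball k x & gball k y].
  have : gball k y \subset ~: gball k x by rewrite -disjoints_subset disjoint_sym.
  by move=> /vol_mono; have := vol_setC (gball k x); lia.
rewrite -setI_eq0 => /set0Pn[z]; rewrite inE => /andP[/gball_reach xz].
by move=> /gball_reach/reach_sym; exact: reach_trans.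
Qed.

Lemma expansion_diam n : (#|K| <= n)%N ->
  (diam R K <= ((8 + 2 / ln 2) * (ln n%:R / psi))%:E)%E.
Proof.
move=> Kn; have /andP[psi0 psi1] := psi_01; have l2 := ln2_gt0 R.
have ln2n : ln 2 <= ln n%:R :> R by apply: lnn_ge; exact: leq_trans Kn.
have lnK : ln #|K|%:R <= ln n%:R :> R by apply: ler_ln_nat => //; exact: ltnW.
(* Rounding up costs at most 1 per ball; the total of 2 is absorbed by the term [2 / ln 2], since
   [psi <= 1] and [ln 2 <= ln n]. *)
set k := (Num.truncn (4 * ln n%:R / psi)).+1.
have large : 4 * ln #|K|%:R < psi * k%:R.
  rewrite [ltRHS]mulrC -ltr_pdivrMr //; apply: le_lt_trans (truncnS_gt (4 * ln n%:R / psi)).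
  by rewrite ler_pM2r ?invr_gt0 // ler_pM2l.
have kle : k%:R <= 4 * (ln n%:R / psi) + 1.
  rewrite /k -[leLHS]natr1 lerD2r mulrA truncn_le divr_ge0 ?(ltW psi0) //; lra.
have one_le : 1 <= ln n%:R / psi / ln 2.
  rewrite ler_pdivlMr // mul1r ler_pdivlMr // (le_trans _ ln2n) //.
  by rewrite ler_piMr // ltW.
apply: ge_ereal_sup => _ [[x y] _ <-] /=.
apply: le_trans (dist_half_balls x y large) _.
rewrite lee_fin natrD.
have -> : (8 + 2 / ln 2) * (ln n%:R / psi) =
  8 * (ln n%:R / psi) + 2 * (ln n%:R / psi / ln 2).
  by field; rewrite !gt_eqF.
lra.
Qed.

End Expansion.

(** * Families of cores and assembly of the theorem *)

Lemma core_induced (R : realType) (G : sgraph) (h : R) (S : {set G}) :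
    (1 < #|G|)%N -> 0 < h -> is_core h S ->
  let psi : R := ln 2 / (5 * ln #|G|%:R) in
  [/\ (1 < #|induced S|)%N, forall v : induced S, h / 24 <= (deg v)%:R
    & forall A : {set induced S}, A != set0 -> ~: A != set0 ->
        psi * (minn (vol A) (vol (~: A)))%:R <= (cross A (~: A))%:R].
Proof.
move=> G1 h0 coreS psi; split.
- by rewrite card_induced (core_card G1 h0 coreS).
- move=> v; rewrite deg_cross cross_lift lift_set1 lift_setT.
  exact: (core_deg G1 h0 coreS (valP v)).
- move=> A A0 cA0; rewrite !vol_cross !cross_lift lift_setC lift_setT.
  apply: (core_expansion G1 h0 coreS (lift_sub A)).
    by rewrite -card_gt0 card_lift card_gt0.
  by rewrite -lift_setC -card_gt0 card_lift card_gt0.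
Qed.

(** Take [F] maximal under inclusion. A non-sparse [X] outside its cover has
    [h * #|X| <= vol X < 6 * cross X X], so [core_exists] finds a core inside [X] that could join
    [F]. *)
Lemma maximal_core_family (R : realType) (G : sgraph) (h : R) :
    (1 < #|G|)%N -> 0 < h -> (forall v : G, h <= (deg v)%:R) ->
  exists F : {set {set G}},
    [/\ trivIset F, set0 \notin F, forall S, S \in F -> is_core h S
      & forall X : {set G}, X \subset ~: cover F -> (6 * cross X X <= vol X)%N].
Proof.
move=> G1 h0 degG.
pose good (F : {set {set G}}) :=
  [&& trivIset F, set0 \notin F & [forall S in F, is_core h S]].
have [|F Fmax _] := @maxset_exists _ good set0.
  apply/and3P; split; rewrite ?inE //; last by apply/forall_inP => S; rewrite inE.
  by apply/trivIsetP => A B; rewrite inE.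
have /and3P[triv F0 /forall_inP cores] := maxsetp Fmax.
exists F; split=> // X XF; rewrite leqNgt; apply/negP => dense.
have X0 : X != set0.
  by apply: contraTneq dense => ->; rewrite /vol /cross !big_set0.
have volX : h * #|X|%:R <= (vol X)%:R.
  by rewrite /vol natr_sum mulr_natr -sumr_const ler_sum.
have [|S coreS SX] := core_exists G1 (ltW h0) X0.
  by apply: le_trans volX _; rewrite -natrM ler_nat ltnW.
have S0 : S != set0 by case/and3P: coreS.
have disj : {in F, forall B : {set G}, [disjoint S & B]}.
  move=> B BF; rewrite disjoint_sym disjoints_subset -(setCK B) setCS.
  apply: subset_trans SX _; apply: subset_trans XF _.
  by rewrite setCS; exact: bigcup_sup.
have [trivSF SF] := trivIsetU1 disj triv F0.
have goodSF : good (S |: F).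
  apply/and3P; split=> //; first by rewrite !inE negb_or eq_sym S0.
  by apply/forall_inP => T; rewrite !inE => /orP[/eqP -> //|/cores].
have SFF := maxsetsup Fmax goodSF (subsetUr _ _).
by rewrite -SFF !inE eqxx in SF.
Qed.

(** A vertex of a core has at least [h / 24] neighbours in it, so each of the disjoint cores has at
    least that many vertices. *)
Lemma core_family_card (R : realType) (G : sgraph) (h : R) (F : {set {set G}}) :
    (1 < #|G|)%N -> 0 < h -> trivIset F ->
  (forall S, S \in F -> is_core h S) -> #|F|%:R <= 24 * #|G|%:R / h.
Proof.
move=> G1 h0 /eqP triv cores; rewrite ler_pdivlMr //.
have : (cover F) \subset [set: G] by exact: subsetT.
move=> /subset_leq_card; rewrite cardsT -triv -(ler_nat R) natr_sum => sumF.
suff : \sum_(S in F) h / 24 <= \sum_(S in F) #|S|%:R.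
  by rewrite sumr_const -mulr_natl; lra.
apply: ler_sum => S /cores coreS; have /and3P[/set0Pn[v vS] _ _] := coreS.
apply: le_trans (core_deg G1 h0 coreS vS) _.
by rewrite ler_nat cross1_le.
Qed.

Theorem theoremB1 (R : realType) :
  exists Ct cphi Cd Cl : R,
    [/\ 0 < Ct, 0 < cphi, 0 < Cd & 0 < Cl] /\
    forall (n : nat) (H : sgraph) (h : R),
      #|H| = n -> 0 < h -> (forall v : H, h <= (deg v)%:R) ->
      exists (F : {set {set H}}) (phi : R),
        [/\ finset.trivIset F, finset.set0 \notin F,
            #|F|%:R <= Ct * (n%:R * ln n%:R / h)
          & cphi / ln n%:R <= phi] /\
        (forall K : {set H}, K \in F ->
          [/\ expander phi (induced K),
              forall u : induced K, phi * h / 3 <= (deg u)%:R,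
              (diam R (induced K) <= (Cd * (ln n%:R / phi))%:E)%E
            & edge_connected (phi * h / 3) (induced K)]) /\
        (forall u : H, u \notin finset.cover F ->
          exists P : seq (seq H),
            [/\ 2 * h / 3 <= (size P)%:R,
                edge_disjoint u P
              & forall p : seq H, p \in P ->
                  [/\ simple_path u p,
                      last u p \in finset.cover F
                    & (size p)%:R <= Cl * ln n%:R]]).
Proof.
have l2 := ln2_gt0 R.
(* The factor [1 / ln 2] in the first constant pays for [ln n]. The 40 is 5 times 8: [phi] is an
   eighth of the expansion constant of the cores, so that [phi * h / 3] equals that constant times
   their degree bound [h / 24]. *)
exists (24 / ln 2), (ln 2 / 40), (8 + 2 / ln 2), (3 / ln 2); split.
  by split; rewrite ?addr_gt0 ?divr_gt0.
move=> n H h nH h0 degH.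
(* For [n <= 1] the positive minimum degree leaves no vertex. Since [ln n = 0] and division by 0
   gives 0, the empty family with [phi = 0] works. *)
have [n1|n1] := leqP n 1.
  have noH (v : H) : False.
    have : (0 < deg v)%N by rewrite -(ltr0n R) (lt_le_trans h0).
    rewrite card_gt0 => /set0Pn[w]; rewrite inE => vw.
    have : (#|[set v; w]| <= 1)%N by rewrite (leq_trans (max_card _)) ?nH.
    by rewrite cards2; case: eqVneq vw => // <-; rewrite adj_irrefl.
  have -> : ln n%:R = 0 :> R.
    by case: (n) n1 => [|[|//]] _; rewrite ?ln1 // ln0.
  exists set0, 0; split; last by split=> [K|u]; [rewrite inE | case: (noH u)].
  rewrite cards0 inE invr0 !mulr0 mul0r mulr0; split=> //.
  by apply/trivIsetP => A B; rewrite inE.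
subst n.
have [F [triv F0 cores sparse]] := maximal_core_family n1 h0 degH.
have ln2n := lnn_ge R n1; have lnn0 := lnn_gt0 R n1.
set L := ln #|H|%:R in ln2n lnn0 *.
have ln2L : ln 2 / L <= 1 by rewrite ler_pdivrMr ?mul1r.
have ln2L0 : 0 < ln 2 / L by rewrite divr_gt0.
have psiE : ln 2 / (5 * L) = ln 2 / L / 5 by field; rewrite gt_eqF.
have phiE : ln 2 / 40 / L = ln 2 / L / 40 by field; rewrite gt_eqF.
exists F, (ln 2 / 40 / L); rewrite phiE; split; last split.
- split=> //; apply: le_trans (core_family_card n1 h0 triv cores) _.
  rewrite !mulrA ler_pM2r ?invr_gt0 // -!mulrA ler_pM2l // mulrCA.
  by rewrite ler_peMr // mulrC ler_pdivlMr ?mul1r.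
- move=> K KF; have [K1 degK expK] := core_induced n1 h0 (cores K KF).
  rewrite -/L psiE in expK.
  have psi01 : 0 < ln 2 / L / 5 <= 1 by apply/andP; split; lra.
  have d0 : 0 < h / 24 by lra.
  split.
  + by apply: (expansion_expander psi01 d0 degK K1 expK); lra.
  + by move=> u; apply: le_trans (degK u); nra.
  + have KH : (#|induced K| <= #|H|)%N by rewrite card_induced max_card.
    apply: le_trans (expansion_diam psi01 d0 degK K1 expK KH) _.
    rewrite lee_fin ler_pM2l; last by rewrite addr_gt0 ?divr_gt0.
    by rewrite ler_pM2l // lef_pV2 ?posrE; lra.
  + by apply: (expansion_edge_connected psi01 degK K1 expK); nra.
- move=> u uF; have [k k_large k_small] := log2_sq_bound R n1.
  have deg_gt0 (v : H) : (0 < deg v)%N by rewrite -(ltr0n R) (lt_le_trans h0).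
  have uB : u \in ~: cover F by rewrite inE.
  have [P [sizeP disjP pathsP]] := sparse_routing sparse deg_gt0 k_large uB.
  exists P; split=> //.
    move: sizeP; rewrite -(ler_nat R) !natrM; have := degH u; lra.
  move=> p /pathsP[simp lst sz]; split=> //.
    by move: lst; rewrite inE negbK.
  by apply: le_trans k_small; rewrite ler_nat.
Qed.
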